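(* There is a compact Haar-countable subset of $\mathbb{R}$ which is not Haar-finite.
   Context: A Cantor set is a homeomorphic copy of $2^\omega$. A set $A\subseteq\mathbb{R}$ is Haar-countable (respectively Haar-finite) if there are a Borel set $B\subseteq\mathbb{R}$ with $A\subseteq B$ and a Cantor set $C\subseteq\mathbb{R}$ such that for all $x\in\mathbb{R}$ the set $(C+x)\cap B$ is at most countable (respectively, finite). *)

(* Defs.v *)
From HB Require Import structures.
From mathcomp Require Import all_boot all_order all_algebra.
From mathcomp Require Import all_classical all_reals all_analysis.

Set Implicit Arguments.
Unset Strict Implicit.
Unset Printing Implicit Defensive.

Import Order.TTheory GRing.Theory Num.Theory.
Import numFieldNormedType.Exports.

Local Open Scope classical_set_scope.
Local Open Scope ring_scope.

(* [g] matters only on [C]: since [range f = C] and [g] is a left inverse of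
   [f], its restriction to [C] is the inverse of the homeomorphism. *)
Definition cantor_set (R : realType) (C : set R) : Prop :=
  exists (f : cantor_space -> R) (g : R -> cantor_space),
    [/\ range f = C, cancel f g, continuous f & {within C, continuous g}].

Definition translate (R : realType) (C : set R) (x : R) : set R :=
  [set y + x | y in C].

(* The canonical [measurable] sets of a [realType] are its Borel sets. *)
Definition Haar_countable (R : realType) (A : set R) : Prop :=
  exists B C : set R,
    [/\ measurable B, A `<=` B, cantor_set C &
        forall x : R, countable (translate C x `&` B)].

Definition Haar_finite (R : realType) (A : set R) : Prop :=
  exists B C : set R,
    [/\ measurable B, A `<=` B, cantor_set C &
        forall x : R, finite_set (translate C x `&` B)].

(* Main.v *)
Require Import Defs.
From HB Require Import structures.
From mathcomp Require Import all_boot all_order all_algebra.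
From mathcomp Require Import all_classical all_reals all_analysis.
From mathcomp Require Import ring lra.
Import Order.TTheory GRing.Theory Num.Theory.
Import numFieldNormedType.Exports.

(* Call [y] good at level [j] when [16 ^ j * y] lies in [[0, 1/4]] modulo 1, and
   split the levels into infinitely many infinite classes.  Let [A] consist of
   the [y] in [[-2, 2]] that are good at all levels of class 0, or, for some [n],
   at all levels of class [n + 1] and at the levels [j <= n] of class 0.

   Spreading every binary digit of [z] over infinitely many levels, one in each
   class, gives a Cantor set of points [spread z]: if [z] and [w] differ at digit
   [k], the two points differ by about 1/2 modulo 1 at a level of each class.  So
   every translate meets each layer (all levels of one class good) in at most one
   point, and [A] is covered by the countably many layers.

   Conversely, any Cantor set contains a point [c] and points [c + d n] with
   [d n != 0] converging to 0 as fast as we like.  Choosing [x] by nested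
   intervals, level by level, one makes [x + d n] good at all levels of class
   [n + 1] and [x] good with some margin at all levels of class 0, so that
   [x + d n] is in [A] for every [n]. *)

Set Implicit Arguments.
Unset Strict Implicit.
Unset Printing Implicit Defensive.

Local Open Scope classical_set_scope.
Local Open Scope ring_scope.

Lemma nested_sup (R : realType) (a b : nat -> R) :
  (forall n, a n <= a n.+1) -> (forall n, b n.+1 <= b n) ->
  (forall n, a n <= b n) -> forall n, a n <= sup (range a) <= b n.
Proof.
move=> ha hb hab n.
have mono_a : {homo a : m k / (m <= k)%N >-> m <= k}.
  exact: (homo_leq (@lexx _ _) (@le_trans _ _) ha).
have mono_b m k : (m <= k)%N -> b k <= b m.
  apply: (homo_leq (r := fun x y => y <= x)) => // x y z xy yz.
  exact: le_trans yz xy.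
have ub k : ubound (range a) (b k).
  move=> _ [m _ <-]; apply: le_trans (mono_a _ _ (leq_maxl m k)) _.
  exact: le_trans (hab _) (mono_b _ _ (leq_maxr m k)).
apply/andP; split; last by apply: ge_sup => //; exists (a 0%N), 0%N.
by apply: ub_le_sup; [exists (b 0%N); exact: ub | exists n].
Qed.

(** * Windows, layers and the compact set *)

Section digit_windows.
Variable R : realType.
Implicit Types (x y : R) (j k m n : nat) (z : cantor_space).

(* Avoiding the open gaps [(q + 1/4, q + 1)] makes closedness immediate. *)
Definition window j : set R :=
  [set y | forall q : int, 16 ^+ j * y <= q%:~R + 4^-1 \/ q%:~R + 1 <= 16 ^+ j * y].

Lemma window_intro j y (q : int) :
  q%:~R <= 16 ^+ j * y <= q%:~R + 4^-1 -> window j y.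
Proof.
move=> /andP[qy yq] r; case: (leP q r) => qr.
  left; apply: le_trans yq _; rewrite lerD2r ler_int //.
by right; apply: le_trans qy; rewrite -intrD1 ler_int lezD1.
Qed.

Lemma window_elim j y : window j y ->
  exists q : int, q%:~R <= 16 ^+ j * y <= q%:~R + 4^-1.
Proof.
move=> wy; exists (Num.floor (16 ^+ j * y)).
have /andP[l r] := floor_itv (16 ^+ j * y).
rewrite l /=; case: (wy (Num.floor (16 ^+ j * y))) => //.
by rewrite -intrD1 leNgt r.
Qed.

Lemma closed_window j : closed (window j).
Proof.
have cont : continuous (fun y : R => 16 ^+ j * y).
  by move=> y; apply: cvgM; [exact: cvg_cst | exact: cvg_id].
rewrite (_ : window j = \bigcap_(q : int)
    ((fun y : R => 16 ^+ j * y) @^-1` [set t | t <= q%:~R + 4^-1] `|`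
     (fun y : R => 16 ^+ j * y) @^-1` [set t | q%:~R + 1 <= t])).
  apply: closed_bigI => q _; apply: closedU; apply: closed_comp;
    by [move=> ? _; exact: cont | exact: closed_le | exact: closed_ge].
by apply/seteqP; split => y wy q; [move=> _; exact: wy | exact: (wy q I)].
Qed.

(* The pair (class, digit) takes every value, at [j = 2 ^ n * 3 ^ k]. *)
Definition class j := logn 2 j.
Definition digit j := logn 3 j.

Lemma class_digit_surj n k : exists j, class j = n /\ digit j = k.
Proof.
exists (2 ^ n * 3 ^ k)%N; rewrite /class /digit !lognM ?expn_gt0 // !lognX.
by rewrite !logn_prime //= !(muln1, muln0, addn0).
Qed.

Definition head m : set R := [set y | forall j, (j < m)%N -> class j = 0%N -> window j y].
Definition layer n : set R := [set y | forall j, class j = n -> window j y].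
(** Quantifying over [m] gives an intersection of finite unions of closed sets. By the least [n]
    with [layer n.+1 y], the second condition amounts to [layer 0 y], or [head n y] and
    [layer n.+1 y] for some [n]. *)
Definition layered : set R :=
  `[-2, 2] `&` [set y | forall m, head m y \/ exists2 n, (n < m)%N & layer n.+1 y].

Lemma closed_head m : closed (head m).
Proof.
rewrite (_ : head m = \bigcap_(j in [set j | (j < m)%N /\ class j = 0%N]) window j).
  by apply: closed_bigI => j _; exact: closed_window.
by apply/seteqP; split => y hy j; [case=> ? ?; exact: hy | move=> ? ?; exact: hy].
Qed.

Lemma closed_layer n : closed (layer n).
Proof.
rewrite (_ : layer n = \bigcap_(j in [set j | class j = n]) window j).
  by apply: closed_bigI => j _; exact: closed_window.
by apply/seteqP; split => y hy j; exact: hy.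
Qed.

Lemma compact_layered : compact layered.
Proof.
apply: (@subclosed_compact R layered `[-2, 2]%classic _ (@segment_compact R _ _));
  last by move=> y [].
apply: closedI; first exact: itv_closed.
rewrite (_ : [set y | _] =
  \bigcap_m (head m `|` \bigcup_(n in [set n | (n < m)%N]) layer n.+1)).
  apply: closed_bigI => m _; apply: closedU; first exact: closed_head.
  by apply: closed_bigcup => [|n _]; [exact: finite_II | exact: closed_layer].
by apply/seteqP; split => y hy m; [move=> _; exact: hy | exact: (hy m I)].
Qed.

Lemma layered_sub : layered `<=` \bigcup_n layer n.
Proof.
move=> y [_ hy]; have [h0|] := pselect (layer 0 y); first by exists 0%N.
move=> /existsNP[j /not_implyP[j0 wj]].
(* A bad level [j] of class 0 refutes [head j.+1]. *)
have [hj|[n _ ln]] := hy j.+1; last by exists n.+1.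
by case: wj; apply: hj.
Qed.

Lemma head_layer_layered n y :
  -2 <= y <= 2 -> head n.+1 y -> layer n.+1 y -> layered y.
Proof.
move=> yb hy ly; split=> [|m]; first by rewrite /= in_itv /=.
have [mn|nm] := leqP m n.+1; last by right; exists n; [exact: ltnW | exact: ly].
by left=> j jm; apply: hy; exact: leq_trans jm mn.
Qed.

(** * The Cantor set of spread points *)

Definition partial_sum z n : R := \sum_(i < n) (z (digit i))%:R / (2 * 16 ^+ i).
Definition spread z : R := sup (range (partial_sum z)).

(** The constant 8/15 is the sum of the geometric series of [1 / (2 * 16 ^ i)]. *)
Lemma spread_bound z n :
  partial_sum z n <= spread z <= partial_sum z n + 8 / 15 / 16 ^+ n.
Proof.
have pos k : 0 < (16 ^+ k : R)^-1 by rewrite invr_gt0 exprn_gt0.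
have step k : partial_sum z k.+1 = partial_sum z k + (z (digit k))%:R / 2 / 16 ^+ k.
  by rewrite /partial_sum big_ord_recr /= invfM mulrA.
have E k : (16 ^+ k.+1 : R)^-1 = (16 ^+ k)^-1 / 16 by rewrite exprSr invfM mulrC.
pose b k := partial_sum z k + 8 / 15 / 16 ^+ k.
apply: (@nested_sup _ (partial_sum z) b) => k; rewrite /b ?step ?E; have := pos k;
  by case: (z (digit k)) => /=; lra.
Qed.

Lemma partial_sum_int z n : exists q : int, 16 ^+ n * partial_sum z n = q%:~R.
Proof.
elim: n => [|n [q hq]]; first by exists 0; rewrite /partial_sum big_ord0 mulr0.
exists (16 * q + 8 * (z (digit n))%:Z).
rewrite /partial_sum big_ord_recr /= mulrDr exprS -mulrA -/(partial_sum _ _) hq.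
rewrite !(rmorphD, rmorphM) /= -!pmulrn; congr (_ + _).
by field; rewrite expf_neq0 // pnatr_eq0.
Qed.

(** At scale [16 ^ j] the earlier terms are integers, term [j] is 0 or 1/2, and the tail is at most
    1/30. *)
Lemma spread_digit z j : exists q : int,
  q%:~R + (z (digit j))%:R / 2 <= 16 ^+ j * spread z
    <= q%:~R + (z (digit j))%:R / 2 + 30^-1.
Proof.
have [q hq] := partial_sum_int z j; exists q.
have /andP[l r] := spread_bound z j.+1.
have p0 : 0 < (16 ^+ j : R) by rewrite exprn_gt0.
have E : 16 ^+ j * partial_sum z j.+1 = q%:~R + (z (digit j))%:R / 2.
  rewrite /partial_sum big_ord_recr /= mulrDr -/(partial_sum _ _) hq.
  by congr (_ + _); field; rewrite gt_eqF.
have F : 16 ^+ j * (8 / 15 / 16 ^+ j.+1) = 30^-1 :> R.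
  by rewrite exprS; field; rewrite gt_eqF.
by rewrite -E -F -mulrDr !ler_pM2l // l r.
Qed.

(** At a level of class [n] whose digit separates [z] from [w], the spread points differ by 1/2
    modulo 1 up to 1/30, but points of one window differ by at most 1/4 modulo 1. *)
Lemma layer_spread_inj n x z w :
  layer n (spread z + x) -> layer n (spread w + x) -> z = w.
Proof.
wlog suff main : z w / forall k, z k -> ~~ w k -> layer n (spread z + x) ->
    layer n (spread w + x) -> False.
  move=> lz lw; apply/funext => k.
  by case zk : (z k); case wk : (w k) => //; exfalso;
    [apply: (main z w k) | apply: (main w z k)]; rewrite ?zk ?wk.
move=> k zk /negbTE wk lz lw; have [j [jn jk]] := class_digit_surj n k.
have [p] := spread_digit z j; have [q] := spread_digit w j.
rewrite jk zk wk /=.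
have [p'] := window_elim (lz j jn); have [q'] := window_elim (lw j jn).
rewrite !mulrDr; set X := _ * x; set Z := _ * spread z; set W := _ * spread w.
move=> /andP[? ?] /andP[? ?] /andP[? ?] /andP[? ?].
pose r : int := (p' - q') - (p - q).
have Er : (r%:~R : R) = p'%:~R - q'%:~R - (p%:~R - q%:~R) by rewrite !rmorphB.
have r0 : 0 < r by rewrite -(ltr0z R) Er; lra.
have r1 : r < 1 by rewrite -(ltr_int R) Er; lra.
by move: r0; rewrite gtz0_ge1 leNgt r1.
Qed.

(** Translating by [- spread z] moves both points to 0, which lies in every window. *)
Lemma spread_inj : injective spread.
Proof.
move=> z w E; have L : layer 0 (spread z - spread z).
  by move=> j _; apply: (@window_intro _ _ 0); rewrite subrr mulr0 lexx /=; lra.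
by apply: (layer_spread_inj L); rewrite -E.
Qed.

Lemma nbhs_cantor_prefix z n :
  nbhs z [set w : cantor_space | forall i, (i < n)%N -> w (digit i) = z (digit i)].
Proof.
elim: n => [|n IH]; first by apply: filterS filterT.
have H : nbhs z [set w : cantor_space | w (digit n) = z (digit n)].
  apply: (@proj_continuous nat (fun=> bool) (digit n) z [set b | b = z (digit n)]).
  exact: discrete_set1.
apply: filterS2 IH H => w h1 h2 i; rewrite ltnS leq_eqVlt => /orP[/eqP->//|].
exact: h1.
Qed.

Lemma spread_continuous : continuous spread.
Proof.
move=> z; apply/cvgrPdist_le => e e0.
have [n hn] : exists n, (16 ^+ n)^-1 < e.
  exists (Num.bound e^-1); rewrite invf_plt ?posrE ?exprn_gt0 //.
  apply: lt_le_trans (upper_nthrootP (leqnn _)) _.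
  by rewrite lerXn2r ?nnegrE ?ler_nat.
apply: filterS (nbhs_cantor_prefix z n) => w hw.
have E : partial_sum w n = partial_sum z n.
  by apply: eq_bigr => i _; rewrite hw.
have := spread_bound z n; have := spread_bound w n; rewrite E.
have : 0 < (16 ^+ n : R)^-1 by rewrite invr_gt0 exprn_gt0.
move=> ? /andP[? ?] /andP[? ?]; rewrite ler_norml; lra.
Qed.

(** * Failure of Haar-finiteness *)

Lemma digit_chase (e : nat -> R) : exists x, forall j, exists q : int,
  q%:~R + 16^-1 <= 16 ^+ j * (x + e j) <= q%:~R + 3 / 16 /\ (j = 0%N -> q = 0).
Proof.
(* At scale [16 ^ j.+1] the interval from [a j] to [b j] has length 2, so for any shift [e j.+1] it
   has room for a copy of [[1/16, 3/16]] modulo 1; [c] picks the leftmost. A margin of 1/16 inside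
   [[0, 1/4]] remains. *)
pose c j y : int := Num.ceil (16 ^+ j * (y + e j) - 16^-1).
pose next j y := ((c j y)%:~R + 16^-1) / 16 ^+ j - e j.
pose a := fix a j := if j is i.+1 then next j (a i) else 16^-1 - e 0%N.
pose b j := a j + 8^-1 / 16 ^+ j.
have p0 j : 0 < (16 ^+ j : R) by rewrite exprn_gt0.
have aS j : 16 ^+ j.+1 * a j.+1 = (c j.+1 (a j))%:~R + 16^-1 - 16 ^+ j.+1 * e j.+1.
  by rewrite /= /next mulrBr mulrC divfK // gt_eqF.
have bE j : 16 ^+ j * b j = 16 ^+ j * a j + 8^-1.
  by rewrite /b mulrDr mulrCA divff ?mulr1 // gt_eqF.
have /(_ _)/andP hx : forall j, a j <= sup (range a) <= b j.
  apply: nested_sup => j.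
  - rewrite -(ler_pM2l (p0 j.+1)) aS.
    have := ceil_ge (16 ^+ j.+1 * (a j + e j.+1) - 16^-1).
    by rewrite -/(c _ _) mulrDr; lra.
  - have E : 16 ^+ j.+1 * b j = 16 ^+ j.+1 * a j + 2.
      by rewrite exprS -!mulrA bE; field.
    rewrite -(ler_pM2l (p0 j.+1)) bE aS E.
    have /andP[+ _] := ceil_itv (16 ^+ j.+1 * (a j + e j.+1) - 16^-1).
    by rewrite -/(c _ _) intrB mulrDr; lra.
  - by rewrite lerDl divr_ge0 // ltW.
exists (sup (range a)) => j; have [l r] := hx j.
move: l r; rewrite -(ler_pM2l (p0 j)) -[_ <= b j](ler_pM2l (p0 j)) bE.
case: j => [|j].
  by exists 0; split=> //; move: l r; rewrite /= expr0 !mul1r; lra.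
by exists (c j.+1 (a j)); split=> //; move: l r; rewrite aS mulrDr; lra.
Qed.

Lemma small_differences (f : cantor_space -> R) z (eps : nat -> R) :
  injective f -> continuous f -> (forall n, 0 < eps n) ->
  exists w : nat -> cantor_space, forall n, f (w n) - f z != 0 /\ `|f (w n) - f z| <= eps n.
Proof.
move=> finj fcont eps0.
have H n : exists w, f w - f z != 0 /\ `|f w - f z| <= eps n.
  have [_ lim] := cantor_perfect.
  have : limit_point [set: cantor_space] z by rewrite lim.
  have U : nbhs z [set w | `|f w - f z| <= eps n].
    have /cvgrPdist_le/(_ _ (eps0 n)) := fcont z.
    by apply: filterS => w; rewrite distrC.
  move=> /(_ _ U)[w [wz _ hw]]; exists w; split=> //.
  by rewrite subr_eq0; apply: contra_neq wz; exact: finj.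
by have [w hw] := choice H; exists w.
Qed.

(** A finite range would be closed, so its complement would be a neighbourhood of 0 containing no
    term. *)
Lemma infinite_range_cvg0 (d : nat -> R) :
  (forall n, d n != 0) -> d @ \oo --> 0 -> infinite_set (range d).
Proof.
move=> d0 dto fin.
have /closed_openC op : closed (range d).
  by apply: (accessible_finite_set_closed.1 (hausdorff_accessible (@Rhausdorff R))).
have /dto [N _ hN] : nbhs (0 : R) (~` range d).
  by apply: open_nbhs_nbhs; split => // -[n _ E]; have := d0 n; rewrite E eqxx.
by apply: (hN N (leqnn N)); exists N.
Qed.

Lemma not_Haar_finite_layered : ~ Haar_finite layered.
Proof.
move=> [B [C [_ AB [f [g [<- fK fcont _]]] fin]]].
(* Here [eps n] is [1 / 16 ^ n.+1], which keeps [16 ^ j * d n] within the margin 1/16 for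
   [j <= n]. *)
pose eps : nat -> R := geometric 16^-1 16^-1.
have eps0 n : 0 < eps n by rewrite /eps /= mulr_gt0 ?exprn_gt0 ?invr_gt0.
pose z : cantor_space := fun=> false.
have [w hw] := small_differences z (can_inj fK) fcont eps0.
pose d n := f (w n) - f z.
(* Levels of class [n.+1] serve [x + d n]; those of class 0 serve [x] itself. *)
pose e j := if class j is n.+1 then d n else 0.
have [x hx] := digit_chase e.
have dM n j : (j <= n)%N -> - 16^-1 <= 16 ^+ j * d n <= 16^-1.
  move=> jn; rewrite -ler_norml normrM ger0_norm ?exprn_ge0 //.
  apply: le_trans (_ : 16 ^+ j * eps n <= _).
    by rewrite ler_pM2l ?exprn_gt0 //; case: (hw n).
  rewrite /eps /= exprVn mulrCA ler_piMr ?invr_ge0 // ler_pdivrMr ?exprn_gt0 // mul1r.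
  by rewrite ler_weXn2l ?ler1n.
have inA n : layered (x + d n).
  apply: (@head_layer_layered n).
  (* Level 0 has class 0 because [logn 2 0 = 0], so [e 0] vanishes and [x] lies in
     [[1/16, 3/16]]. *)
  - have [q [+ /(_ erefl) q0]] := hx 0%N; have := dM n 0%N isT.
    by rewrite q0 expr0 !mul1r /e /= addr0; lra.
  - move=> j jn j0; have [q [+ _]] := hx j; have := dM n j jn.
    rewrite /e j0 addr0 => ? ?; apply: (@window_intro _ _ q).
    by rewrite mulrDr; lra.
  - move=> j jn; have [q [+ _]] := hx j.
    rewrite /e jn => ?; apply: (@window_intro _ _ q); lra.
have : infinite_set (range d).
  apply: infinite_range_cvg0 => [n|]; first by case: (hw n).
  apply: norm_cvg0; apply: (@squeeze_cvgr _ _ _ _ (fun=> 0) eps).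
  - by near=> n; rewrite normr_ge0; case: (hw n).
  - exact: cvg_cst.
  - by apply: cvg_geometric; rewrite ger0_norm ?invr_ge0 // invf_lt1 ?ltr1n.
(* Each [x + d n] is [f (w n)] translated by [x - f z], the same translation for all [n]. *)
apply; have := finite_image (fun y => y - x) (fin (x - f z)).
apply: sub_finite_set => _ [n _ <-]; exists (x + d n); last by rewrite /= addrAC subrr add0r.
split; last by apply: AB.
by exists (f (w n)); [exists (w n) | rewrite /d; ring].
Unshelve. all: by end_near.
Qed.

End digit_windows.

(** * Haar-countability *)

Lemma cantor_set_range (R : realType) (f : cantor_space -> R) :
  continuous f -> injective f -> cantor_set (range f).
Proof.
move=> fcont finj; pose g y : cantor_space := get [set z | f z = y].
have fK : cancel f g by move=> z; apply: finj; apply: (@getPex _ [set w | f w = f z]); exists z.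
exists f, g; split=> //; apply/continuous_closedP => F clF.
(* By compactness [f] is a closed map, and on the range the preimage of [F] under [g] is the image
   of [F] under [f]. *)
apply/closed_subspaceP; exists (f @` F).
  apply: compact_closed; first exact: Rhausdorff.
  apply: continuous_compact; first exact: continuous_subspaceT.
  exact: subclosed_compact clF cantor_space_compact (@subsetT _ _).
apply/seteqP; split=> y [Hy [z _ E]]; subst y; move: Hy.
  move=> [w Fw /finj E]; subst w; split; last by exists z.
  by change (F (g (f z))); rewrite fK.
by move=> /= Fz; split; exists z => //; rewrite -(fK z); exact: Fz.
Qed.

Lemma Haar_countable_layered (R : realType) : Haar_countable (@layered R).
Proof.
exists (@layered R), (range (@spread R)); split=> //.
- apply: measurable_realfun.compact_measurable; exact: compact_layered.
- exact: cantor_set_range (@spread_continuous R) (@spread_inj R).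
move=> x.
apply: (@sub_countable _ _ _ (\bigcup_n (translate (range (@spread R)) x `&` layer n))).
  apply: subset_card_le => y [Cy /layered_sub[n _ ny]]; by exists n.
apply: bigcup_countable => // n _; apply: finite_set_countable.
have [->|/set0P[y yL]] := eqVneq (translate (range (@spread R)) x `&` layer n) set0.
  exact: finite_set0.
apply: sub_finite_set (finite_set1 y) => t [].
case: yL => -[_ [z _ <-] <-] lz [_ [w _ <-] <-] lw.
by rewrite (layer_spread_inj lw lz).
Qed.

Theorem theorem7p1 (R : realType) :
  exists A : set R, [/\ compact A, Haar_countable A & ~ Haar_finite A].
Proof.
exists (@layered R); split; first exact: compact_layered.
  exact: Haar_countable_layered.
exact: not_Haar_finite_layered.
Qed.
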